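(* Let $J,K\ge 1$ be integers, let $P=(p_{j,k})_{0\le j\le J,\,0\le k\le K}$ and $Q=(q_{k,j})_{1\le k\le K,\,1\le j\le J}$ be probability distributions satisfying the consistency conditions (C1) and (C2) of the context, and let $\delta\in(1/2,1)$ be fixed. For each admissible $N$, consider the random directed graph on the nodes $\{1,\dots,N\}$ generated by the algorithm described in the context. Let $\mathcal{V}_{j,k}$ be its number of nodes of type $(j,k)$, $\mathcal{E}_{k,j}$ its number of edges of type $(k,j)$, and $\mathcal{E}$ its total number of edges. Then for any $\varepsilon>0$, $$\lim_{N\to\infty}\mathbb{P}\left[\sum_{j\in[J]_0,\,k\in[K]_0}\left|\frac{\mathcal{V}_{j,k}}{N}-p_{j,k}\right|+\sum_{k\in[K]_1,\,j\in[J]_1}\left|\frac{\mathcal{E}_{k,j}}{\mathcal{E}}-q_{k,j}\right|>\varepsilon\right]=0.$$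
   Context: Notation. For integers $0\le l\le n$ write $[n]_l=\{l,\ldots,n\}$; $\lceil x\rceil$ is the smallest integer $\ge x$. Graphs are directed and may contain self-loops and multiple edges. A node $v$ is of type $(j,k)$ if its in-degree is $j$ and its out-degree is $k$. A directed edge $e=\langle v,w\rangle$ (from $v$ to $w$) is of type $(k,j)$ if the out-degree of $v$ is $k$ and the in-degree of $w$ is $j$. Distributions. $P=(p_{j,k})_{j\in[J]_0,k\in[K]_0}$ and $Q=(q_{k,j})_{k\in[K]_1,j\in[J]_1}$ are probability distributions with marginals $p_j^-=\sum_{k'\in[K]_0}p_{j,k'}$, $p_k^+=\sum_{j'\in[J]_0}p_{j',k}$, $q_k^+=\sum_{j'\in[J]_1}q_{k,j'}$, $q_j^-=\sum_{k'\in[K]_1}q_{k',j}$. With $z=\sum_{k\in[K]_0}kp_k^+$, assumed $>0$, the consistency conditions are: (C1) $q_k^+=kp_k^+/z$ for all $k\in[K]_1$; (C2) $q_j^-=jp_j^-/z$ for all $j\in[J]_1$. Algorithm. Fix $\delta\in(1/2,1)$. $N\in\mathbb{N}$ is admissible if there is $N'\in\mathbb{N}$, $N'\geq 1$, with $N=N'+2\lceil N^\delta\rceil+\max\{J^2,K^2\}$ (true for all large $N$); set $N''=N'+\lceil N^\delta\rceil$. Step 1. Assign to each node $v=1,\ldots,N'$ independently a type $(j_v,k_v)$ with distribution $P$. Generate edges $e=1,\ldots,\lceil zN''\rceil$ with independent types $(k_e,j_e)$ with distribution $Q$, independently of the node-types. For $k\in[K]_1$ and $j\in[J]_1$ put $n_k^+=\sum_{v=1}^{N'}1_{\{k_v=k\}}$,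 $e_k^+=\big\lceil\frac1k\sum_{e=1}^{\lceil zN''\rceil}1_{\{k_e=k\}}\big\rceil$, $n_j^-=\sum_{v=1}^{N'}1_{\{j_v=j\}}$, $e_j^-=\big\lceil\frac1j\sum_{e=1}^{\lceil zN''\rceil}1_{\{j_e=j\}}\big\rceil$. Let $A_N$ be the event that $|n_k^+-p_k^+N'|\le p_k^+N^\delta/2$ and $|e_k^+-p_k^+N''|\le p_k^+N^\delta/2$ for all $k\in[K]_1$, and $|n_j^--p_j^-N'|\le p_j^-N^\delta/2$ and $|e_j^--p_j^-N''|\le p_j^-N^\delta/2$ for all $j\in[J]_1$. If $A_N$ occurs go to Step 2, otherwise go to Step 5. Step 2. For each $k\in[K]_1$ add $r_k^+=ke_k^+-\sum_{e=1}^{\lceil zN''\rceil}1_{\{k_e=k\}}$ edges of type $(k,1)$; for each $j\in[J]_1$ add $r_j^-=je_j^--\sum_{e=1}^{\lceil zN''\rceil}1_{\{j_e=j\}}$ edges of type $(1,j)$. Set $r^+=\sum_{k\in[K]_1}r_k^+$, $r^-=\sum_{j\in[J]_1}r_j^-$. Step 3. Set the type of each node in $\{N'+1,\ldots,N\}$ to $(0,0)$. Successively for each $k\in[K]_1$, take the first $e_k^+-n_k^++r^-1_{\{k=1\}}$ nodes in $\{N'+1,\ldots,N\}$ having out-degree $0$ and change their out-degrees to $k$. Successively for each $j\in[J]_1$, take the first $e_j^--n_j^-+r^+1_{\{j=1\}}$ nodes in $\{N'+1,\ldots,N\}$ having in-degree $0$ and change their in-degrees to $j$. (On $A_N$ these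 numbers are nonnegative and enough nodes are available.) Step 4. For each $k\in[K]_1$, assign to each node of out-degree $k$ exactly $k$ uniformly chosen edges $e$ with $k_e=k$ (as edges leaving that node); for each $j\in[J]_1$, assign to each node of in-degree $j$ exactly $j$ uniformly chosen edges $e$ with $j_e=j$ (as edges arriving at that node). Each edge is used exactly once at each end (the numbers match exactly), so these assignments are uniformly random allocations, made independently for the different $k$ and $j$ given the types. Go to Step 6. Step 5. Set node-types $(j_1,k_1)=(0,1)$, $(j_2,k_2)=(1,0)$, $(j_v,k_v)=(0,0)$ for $v=3,\ldots,N$, and insert the single edge $\langle1,2\rangle$. Step 6. Return the constructed graph. Limits $N\to\infty$ are along admissible $N$. *)

(* Defs.v *)
From HB Require Import structures.
From mathcomp Require Import all_boot all_order all_algebra.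
From mathcomp Require Import all_classical all_reals all_analysis.

Set Implicit Arguments.
Unset Strict Implicit.
Unset Printing Implicit Defensive.

Import Order.TTheory GRing.Theory Num.Theory.
Import numFieldNormedType.Exports.

Local Open Scope ring_scope.

(* Finite directed multigraphs on N labelled nodes, self-loops allowed.
   The ordinal v : 'I_N stands for the node v + 1 of {1, ..., N}; likewise an
   edge is an ordinal below the number of edges. *)
Record digraph (N : nat) := Digraph {
  nb_edges : nat;
  source : 'I_nb_edges -> 'I_N;
  target : 'I_nb_edges -> 'I_N
}.

Section Counts.
Variables (N : nat) (G : digraph N).

Definition indeg (v : 'I_N) : nat := #|[set e | target (d := G) e == v]|.

Definition outdeg (v : 'I_N) : nat := #|[set e | source (d := G) e == v]|.

Definition nb_nodes_of_type (j k : nat) : nat :=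
  #|[set v | (indeg v == j) && (outdeg v == k)]|.

Definition nb_edges_of_type (k j : nat) : nat :=
  #|[set e : 'I_(nb_edges G) |
      (outdeg (source e) == k) && (indeg (target e) == j)]|.

End Counts.

(* Ceiling as a natural number; only used on nonnegative reals. *)
Definition nceil (R : realType) (x : R) : nat := `|Num.ceil x|%N.

(* Change the first c zero entries of s to k. *)
Fixpoint set_first_zeros (c k : nat) (s : seq nat) : seq nat :=
  match c, s with
  | c'.+1, x :: s' =>
      if x == 0%N then k :: set_first_zeros c' k s'
      else x :: set_first_zeros c k s'
  | _, _ => s
  end.

Section Model.
Variables (R : realType) (J K : nat).
(* p j k is meant for 0 <= j <= J, 0 <= k <= K and q k j for 1 <= k <= K,
   1 <= j <= J; values outside these ranges are never used. *)
Variables (p q : nat -> nat -> R).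

Definition prob_P : Prop :=
  (forall j k : nat, (j <= J)%N -> (k <= K)%N -> 0 <= p j k) /\
  \sum_(0 <= j < J.+1) \sum_(0 <= k < K.+1) p j k = 1.

Definition prob_Q : Prop :=
  (forall k j : nat, (1 <= k <= K)%N -> (1 <= j <= J)%N -> 0 <= q k j) /\
  \sum_(1 <= k < K.+1) \sum_(1 <= j < J.+1) q k j = 1.

Definition p_in (j : nat) : R := \sum_(0 <= k < K.+1) p j k.
Definition p_out (k : nat) : R := \sum_(0 <= j < J.+1) p j k.
Definition q_out (k : nat) : R := \sum_(1 <= j < J.+1) q k j.
Definition q_in (j : nat) : R := \sum_(1 <= k < K.+1) q k j.

Definition mean_deg : R := \sum_(0 <= k < K.+1) k%:R * p_out k.

Definition consistent_out : Prop :=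
  forall k : nat, (1 <= k <= K)%N -> q_out k = k%:R * p_out k / mean_deg.

Definition consistent_in : Prop :=
  forall j : nat, (1 <= j <= J)%N -> q_in j = j%:R * p_in j / mean_deg.

Variables (delta : R) (N : nat).

Definition Ndelta : R := N%:R `^ delta.

Definition nb_reserve : nat := (2 * nceil Ndelta + maxn (J ^ 2) (K ^ 2))%N.

Definition admissible : Prop :=
  exists2 N' : nat, (1 <= N')%N & N = (N' + nb_reserve)%N.

(* For admissible N, the truncated difference N1 is the unique N' above. *)
Definition N1 : nat := (N - nb_reserve)%N.
Definition N2 : nat := (N1 + nceil Ndelta)%N.
Definition nb_edges1 : nat := nceil (mean_deg * N2%:R).

(* A node sample x lists types (in-degree, out-degree); an edge sample y
   lists pairs (a, b) standing for the edge type (a + 1, b + 1). *)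
Definition node_sample := {ffun 'I_N1 -> 'I_J.+1 * 'I_K.+1}.
Definition edge_sample := {ffun 'I_nb_edges1 -> 'I_K * 'I_J}.

Definition node_weight (x : node_sample) : R := \prod_v p (x v).1 (x v).2.
Definition edge_weight (y : edge_sample) : R :=
  \prod_e q (y e).1.+1 (y e).2.+1.

Section Types.
Variables (x : node_sample) (y : edge_sample).

Definition edge_count_out (k : nat) : nat := #|[set e | (y e).1.+1 == k]|.
Definition edge_count_in (j : nat) : nat := #|[set e | (y e).2.+1 == j]|.

Definition n_out (k : nat) : nat := #|[set v | (x v).2 == k :> nat]|.
Definition n_in (j : nat) : nat := #|[set v | (x v).1 == j :> nat]|.
Definition e_out (k : nat) : nat := nceil ((edge_count_out k)%:R / k%:R : R).
Definition e_in (j : nat) : nat := nceil ((edge_count_in j)%:R / j%:R : R).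

Definition event_A : bool :=
  all (fun k =>
    (`|(n_out k)%:R - p_out k * N1%:R| <= p_out k * Ndelta / 2) &&
    (`|(e_out k)%:R - p_out k * N2%:R| <= p_out k * Ndelta / 2)) (iota 1 K) &&
  all (fun j =>
    (`|(n_in j)%:R - p_in j * N1%:R| <= p_in j * Ndelta / 2) &&
    (`|(e_in j)%:R - p_in j * N2%:R| <= p_in j * Ndelta / 2)) (iota 1 J).

(* Edges added so that k divides the number of edges with source type k. The
   truncated subtractions are exact, e_out and e_in being ceilings. *)
Definition r_out (k : nat) : nat := (k * e_out k - edge_count_out k)%N.
Definition r_in (j : nat) : nat := (j * e_in j - edge_count_in j)%N.
Definition r_out_tot : nat := (\sum_(1 <= k < K.+1) r_out k)%N.
Definition r_in_tot : nat := (\sum_(1 <= j < J.+1) r_in j)%N.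

(* Edge types (out-degree of source, in-degree of target), sampled and added. *)
Definition edge_types : seq (nat * nat) :=
  [seq ((y e).1.+1, (y e).2.+1) | e <- enum 'I_nb_edges1] ++
  flatten [seq nseq (r_out k) (k, 1%N) | k <- iota 1 K] ++
  flatten [seq nseq (r_in j) (1%N, j) | j <- iota 1 J].

(* The truncated subtractions are exact when event_A holds. *)
Definition out_fill (k : nat) : nat :=
  (e_out k + (k == 1%N) * r_in_tot - n_out k)%N.
Definition in_fill (j : nat) : nat :=
  (e_in j + (j == 1%N) * r_out_tot - n_in j)%N.

(* Prescribed degrees of the N nodes: the sampled ones, then the N - N1 reserve
   nodes, initially of type (0, 0) and then filled for k = 1, ..., K in turn. *)
Definition out_degrees : seq nat :=
  [seq val (x v).2 | v <- enum 'I_N1] ++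
  foldl (fun s k => set_first_zeros (out_fill k) k s)
        (nseq (N - N1) 0%N) (iota 1 K).
Definition in_degrees : seq nat :=
  [seq val (x v).1 | v <- enum 'I_N1] ++
  foldl (fun s j => set_first_zeros (in_fill j) j s)
        (nseq (N - N1) 0%N) (iota 1 J).

(* An allocation of edge sources sends each edge e to a node whose
   prescribed out-degree is k_e, every node of prescribed out-degree k receiving
   exactly k edges; similarly for targets. The set of source allocations is the
   product over k of the sets of allocations of the edges with k_e = k, so the
   uniform law on it makes the allocations uniform and independent for the
   different k. Sources and targets are independent of each other. *)
Definition allocation := {ffun 'I_(size edge_types) -> 'I_N}.

Definition source_allocations : {set allocation} :=
  [set s : allocation |
    [forall e, nth 0%N out_degrees (s e) == (nth (0, 0)%N edge_types e).1] &&
    [forall v : 'I_N, #|[set e | s e == v]| == nth 0%N out_degrees v]].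

Definition target_allocations : {set allocation} :=
  [set t : allocation |
    [forall e, nth 0%N in_degrees (t e) == (nth (0, 0)%N edge_types e).2] &&
    [forall v : 'I_N, #|[set e | t e == v]| == nth 0%N in_degrees v]].

Definition allocated_graph (s t : allocation) : digraph N := Digraph s t.

End Types.

End Model.

(* Returned when event_A fails: the single edge from node 1 to node 2; admissibility entails
   N >= 2, so the edgeless graph in the other branch is never used. *)
Definition fallback_graph (N : nat) : digraph N :=
  match N return digraph N with
  | n.+2 => @Digraph n.+2 1 (fun _ => ord0) (fun _ => lift ord0 ord0)
  | n => @Digraph n 0 (fun i => False_rect _ (notF (ltn_ord i)))
                      (fun i => False_rect _ (notF (ltn_ord i)))
  end.

Section Law.
Variables (R : realType) (J K : nat) (p q : nat -> nat -> R).
Variables (delta : R) (N : nat).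

(* Conditional probability, given the sampled types x and y, that the graph
   returned by the algorithm satisfies B. *)
Definition cond_prob_graph (x : node_sample J K delta N)
    (y : edge_sample J K p delta N) (B : pred (digraph N)) : R :=
  if event_A x y then
    let S := source_allocations x y in
    let T := target_allocations x y in
    \sum_(s in S) \sum_(t in T)
      (B (allocated_graph s t))%:R / (#|S| * #|T|)%:R
  else (B (fallback_graph N))%:R.

(* Probability that the graph returned by the algorithm satisfies B. *)
Definition prob_graph (B : pred (digraph N)) : R :=
  \sum_(x : node_sample J K delta N) \sum_(y : edge_sample J K p delta N)
    node_weight p x * edge_weight q y * cond_prob_graph x y B.

Definition type_deviation (G : digraph N) : R :=
  \sum_(0 <= j < J.+1) \sum_(0 <= k < K.+1)
    `|(nb_nodes_of_type G j k)%:R / N%:R - p j k| +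
  \sum_(1 <= k < K.+1) \sum_(1 <= j < J.+1)
    `|(nb_edges_of_type G k j)%:R / (nb_edges G)%:R - q k j|.

End Law.

(* Main.v *)
Require Import Defs.
From mathcomp Require Import all_boot all_order all_algebra.
From mathcomp Require Import all_classical all_reals all_analysis.
From mathcomp Require Import ring lra.

(** The types of the nodes and edges sampled in Step 1 prescribe all the degrees
of the returned graph, so that the allocations of Step 4 play no role: the graph
has the sampled nodes and edges, plus O(N^delta) reserve nodes and O(1) added
edges. By Chebyshev's inequality, with probability 1 - O(N^(1 - 2 delta)) every
type c of probability w(c) is sampled n w(c) +- tau w(c) N^delta times, where n
is the sample size. Errors proportional to w(c) add up over types, so for tau
small this implies the event A_N, and then the type frequencies deviate from P
and Q by O(N^(delta - 1)). *)

Import Order.TTheory GRing.Theory Num.Theory.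
Import numFieldNormedType.Exports.
Local Open Scope ring_scope.

(** * Ceilings and comparison of powers *)

Lemma nceil_ge {R : realType} (x : R) : x <= (nceil x)%:R.
Proof.
rewrite /nceil natr_absz; apply: le_trans (ceil_ge x) _.
by rewrite ler_int ler_norm.
Qed.

Lemma nceil_lt {R : realType} (x : R) : 0 <= x -> (nceil x)%:R < x + 1.
Proof.
move=> x0; rewrite /nceil natr_absz ger0_norm; first by rewrite -ltrBlDr -(intrB _ _ 1) ceilB1_lt.
by rewrite ceil_ge0 (lt_le_trans _ x0) // ltrN10.
Qed.

(** Factor [N ^ a] as [N ^ (a - b)] times [N ^ b]: the first factor reaches [|L|] once [N] is at
    least the [(a - b)]-th root of [|L|]. *)
Lemma powR_dominates {R : realType} {a b : R} (L : R) : 0 <= b -> b < a ->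
  \forall N \near \oo%classic, L * (N : nat)%:R `^ b <= N%:R `^ a.
Proof.
move=> b0 ba; have ab0 : 0 < a - b by rewrite subr_gt0.
near=> N.
have N0 : 0 < N%:R :> R by rewrite ltr0n; near: N; exact: nbhs_infty_gt.
rewrite -[in leRHS](subrK b a) powRD; last by rewrite (gt_eqF N0) implybT.
rewrite ler_wpM2r ?powR_ge0 // (le_trans (ler_norm L)) //.
have -> : `|L| = (`|L| `^ (a - b)^-1) `^ (a - b).
  by rewrite -powRrM mulVf ?powRr1 ?gt_eqF.
rewrite ge0_ler_powR ?nnegrE ?powR_ge0 ?(ltW ab0) ?(ltW N0) //.
near: N; exact: nbhs_infty_ger.
Unshelve. all: by end_near.
Qed.

(** * Independent samples from a finite law: variance and Chebyshev's inequality *)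

Section ProductWeight.
Context {R : realType} {T : finType} (w : T -> R) {n : nat}.
Implicit Types x : {ffun 'I_n -> T}.

Definition type_count x (c : T) : nat := #|[set v | x v == c]|.
Definition sample_weight x : R := \prod_v w (x v).

Hypotheses (w0 : forall c, 0 <= w c) (w1 : \sum_c w c = 1).

Lemma sample_weight_ge0 x : 0 <= sample_weight x.
Proof. exact: prodr_ge0. Qed.

Lemma sum_sample_weight : \sum_x sample_weight x = 1.
Proof. by rewrite -(bigA_distr_bigA (fun _ => w)) big1. Qed.

(** The weight factors over coordinates. If [u] and [v] differ, coordinate [u] contributes the mean
    of [h], which is 0; otherwise it contributes the mean of [h ^+ 2] and every other coordinate
    contributes 1. *)
Lemma sample_cov (h : T -> R) (u v : 'I_n) : \sum_c w c * h c = 0 ->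
  \sum_x sample_weight x * (h (x u) * h (x v)) =
  (u == v)%:R * \sum_c w c * h c ^+ 2.
Proof.
move=> h0.
(* [g i] collects the factors sitting at coordinate [i], so that distributivity turns the sum over
   samples into a product of one-coordinate sums. *)
pose g (i : 'I_n) c := w c * ((if i == u then h c else 1) * (if i == v then h c else 1)).
transitivity (\prod_i \sum_c g i c).
  rewrite bigA_distr_bigA; apply: eq_bigr => x _.
  by rewrite !big_split /= -!big_mkcond !big_pred1_eq.
rewrite (bigD1 u) //= /g eqxx; case: (eqVneq u v) => [<-|uv].
  rewrite mul1r [X in _ * X]big1 ?mulr1 // => i /negbTE ->.
  by under eq_bigr do rewrite !mulr1.
by under eq_bigr do rewrite mulr1; rewrite h0 !mul0r.
Qed.

Lemma type_count_sum x (c : T) : (type_count x c)%:R = \sum_v (x v == c)%:R :> R.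
Proof.
rewrite /type_count -sum1_card natr_sum big_mkcond; apply: eq_bigr => v _.
by rewrite inE; case: eqP.
Qed.

(** This is the binomial variance: the deviation is a sum of centred indicators, and after expanding
    its square only the diagonal terms survive. *)
Lemma type_count_variance (c : T) :
  \sum_x sample_weight x * ((type_count x c)%:R - w c * n%:R) ^+ 2 =
  n%:R * (w c * (1 - w c)).
Proof.
pose h d : R := (d == c)%:R - w c.
have sumc (f : T -> R) : \sum_d w d * ((d == c)%:R * f d) = w c * f c.
  rewrite (bigD1 c) //= eqxx mul1r big1 ?addr0 // => d /negbTE ->.
  by rewrite mul0r mulr0.
have h0 : \sum_d w d * h d = 0.
  under eq_bigr do rewrite /h mulrBr -[X in w _ * X]mulr1.
  by rewrite big_split /= sumc sumrN -mulr_suml w1; ring.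
have h2 : \sum_d w d * h d ^+ 2 = w c * (1 - w c).
  transitivity (\sum_d (w d * ((d == c)%:R * (1 - w c *+ 2)) + w d * w c ^+ 2)).
    by apply: eq_bigr => d _; rewrite /h; case: eqP => _ /=; ring.
  by rewrite big_split /= sumc -mulr_suml w1; ring.
transitivity (\sum_x \sum_u \sum_v sample_weight x * (h (x u) * h (x v))).
  apply: eq_bigr => x _.
  have -> : (type_count x c)%:R - w c * n%:R = \sum_v h (x v).
    by rewrite type_count_sum big_split /= sumrN sumr_const card_ord mulr_natr.
  rewrite expr2 mulr_suml mulr_sumr; apply: eq_bigr => u _.
  by rewrite !mulr_sumr.
rewrite exchange_big /=; under eq_bigr do rewrite exchange_big /=.
under eq_bigr => u _ do under eq_bigr => v _ do rewrite sample_cov // h2.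
transitivity (\sum_(u < n) w c * (1 - w c)).
  apply: eq_bigr => u _; rewrite -mulr_suml (bigD1 u) //= eqxx big1.
    by rewrite addr0 mul1r.
  by move=> v; rewrite eq_sym => /negbTE ->.
by rewrite sumr_const card_ord mulr_natl.
Qed.

(* For [w c = 0] the right-hand side is [0]: such a type is almost surely absent. *)
Lemma type_count_chebyshev (c : T) (t : R) : 0 < t ->
  \sum_x sample_weight x * (t * w c < `|(type_count x c)%:R - w c * n%:R|)%R%:R
  <= n%:R / (t ^+ 2 * w c).
Proof.
move=> t0; pose D x := (type_count x c)%:R - w c * n%:R.
(* Markov's inequality for the squared deviation. The threshold [s] stays free because the case
   [w c = 0] uses another one. *)
have markov (s : R) : 0 < s ->
    \sum_x sample_weight x * (s < `|D x|)%R%:R <= n%:R * (w c * (1 - w c)) / s ^+ 2.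
  move=> s0; rewrite -type_count_variance ler_pdivlMr ?exprn_gt0 // mulr_suml.
  apply: ler_sum => x _; rewrite -mulrA ler_wpM2l ?sample_weight_ge0 //.
  case: (ltP s `|D x|) => [lt_s|_] /=; last by rewrite mul0r sqr_ge0.
  by rewrite mul1r -[leRHS]real_normK ?num_real // lerXn2r ?nnegrE ?normr_ge0 ?(ltW s0) ?(ltW lt_s).
have [wc0|wcN0] := eqVneq (w c) 0.
  (* Here the variance is 0, and the threshold 1/2 detects every nonzero count since counts are
     integers. *)
  have half0 : 0 < 2^-1 :> R by rewrite invr_gt0 ltr0n.
  have := markov _ half0; rewrite wc0 !(mulr0, mul0r, invr0); apply: le_trans.
  apply: ler_sum => x _; rewrite ler_wpM2l ?sample_weight_ge0 // ler_nat.
  rewrite /D wc0 mul0r subr0 normr_nat ltr0n.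
  case: (type_count x c) => [|m] //=; rewrite (_ : (_ < _)%R) //.
  by rewrite (lt_le_trans (y := 1)) ?ler1n // invf_lt1 ?ltr1n ?ltr0n.
have wc : 0 < w c by rewrite lt_neqAle eq_sym wcN0 w0.
apply: le_trans (markov _ (mulr_gt0 t0 wc)) _.
rewrite -mulrA ler_wpM2l // exprMn expr2 [leRHS](_ : _ = w c / (t * t * (w c) ^+ 2)).
  rewrite ler_pM2r ?invr_gt0 ?mulr_gt0 ?exprn_gt0 //.
  by rewrite ler_piMr ?w0 // gerBl w0.
by field; rewrite gt_eqF // gt_eqF.
Qed.

End ProductWeight.

(** * Effect of rounding up the edge counts *)

Lemma nceil0 {R : realType} : nceil (0 : R) = 0%N.
Proof. by rewrite /nceil ceil0. Qed.

(** Rounding [c / k] up adds less than 1, hence less than [k] after multiplication by [k]. This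
    controls the edges added in Step 2. *)
Lemma nceil_remainder {R : realType} (k c : nat) : (0 < k)%N ->
  (k * nceil (c%:R / k%:R : R) - c <= k)%N.
Proof.
move=> k0; have kR : 0 < k%:R :> R by rewrite ltr0n.
rewrite leq_subLR -(ler_nat R) natrM natrD -ler_pdivlMl //.
by rewrite mulrDr mulVf ?gt_eqF // mulrC ltW // nceil_lt.
Qed.

(** Dividing the error [t * qk] by [k] gives [t * pk / z], at most [pk * d / 4]. The outer ceiling
    costs at most 1 and the ceiling of [z * n] at most [pk / z]; together they use the other
    quarter. *)
Lemma nceil_div_dev {R : realType} {k c n : nat} {pk z qk t d : R} :
  (0 < k)%N -> 0 < z -> 0 <= pk ->
  qk = k%:R * pk / z -> t <= z * d / 4 -> (0 < pk -> 1 + pk / z <= pk * d / 4) ->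
  `|c%:R - qk * (nceil (z * n%:R))%:R| <= t * qk ->
  `|(nceil (c%:R / k%:R : R))%:R - pk * n%:R| <= pk * d / 2.
Proof.
move=> k0 z0 pk0 -> tzd large.
have kR : 0 < k%:R :> R by rewrite ltr0n.
(* If [pk = 0], the tolerance is 0 and the hypothesis forces [c = 0], so nothing is lost in
   rounding. *)
move: pk0; rewrite le_eqVlt => /predU1P[<-|pk0].
  rewrite !(mulr0, mul0r) subr0 normr_nat lern0 => /eqP ->.
  by rewrite mul0r nceil0 subrr normr0.
move: (large pk0) => {large}.
have cge := nceil_ge (c%:R / k%:R : R).
have := nceil_lt (c%:R / k%:R : R) (divr_ge0 (ler0n _ _) (ltW kR)).
have mge := nceil_ge (z * n%:R).
have := nceil_lt (z * n%:R) (mulr_ge0 (ltW z0) (ler0n _ _)).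
move: (nceil _)%:R mge (nceil _)%:R cge => m mge a cge mlt alt large dev.
have {}dev : `|c%:R / k%:R - pk * (m / z)| <= pk * d / 4.
  rewrite (_ : _ - _ = (c%:R - k%:R * pk / z * m) / k%:R); last by field; rewrite !gt_eqF.
  rewrite normrM normfV normr_nat ler_pdivrMr // (le_trans dev) //.
  rewrite [leRHS](_ : _ = z * d / 4 * (k%:R * pk / z)); last by field; rewrite gt_eqF.
  by rewrite ler_wpM2r // !mulr_ge0 // ?invr_ge0 ltW.
have mz1 : pk * n%:R <= pk * (m / z).
  by rewrite ler_pM2l // ler_pdivlMr // mulrC.
have mz2 : pk * (m / z) <= pk * n%:R + pk / z.
  rewrite -mulrDr ler_pM2l // ler_pdivrMr // mulrDl mulVf ?gt_eqF //.
  by rewrite (mulrC n%:R) ltW.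
move: dev; rewrite !ler_norml => /andP[d1 d2]; apply/andP; split; lra.
Qed.

(** * From counts of single types to marginals and frequencies *)

Section Deviation.
Context {R : realType} {T : finType} {w : T -> R} {t : R} {n : nat}.

(** Errors proportional to the weights add up to an error proportional to the total weight, so
    marginal counts inherit the same relative tolerance [t]. *)
Lemma event_dev (x : {ffun 'I_n -> T}) (P : pred T) :
  (forall c, `|(type_count x c)%:R - w c * n%:R| <= t * w c) ->
  `|#|[set v | P (x v)]|%:R - (\sum_(c | P c) w c) * n%:R|
    <= t * \sum_(c | P c) w c.
Proof.
move=> dev; have -> : #|[set v | P (x v)]| = (\sum_(c | P c) type_count x c)%N.
  rewrite -sum1_card (partition_big x P) => [|v]; last by rewrite inE.
  apply: eq_bigr => c Pc; rewrite /type_count -sum1_card; apply: eq_bigl => v.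
  by rewrite !inE; case: eqP => [->|]; rewrite ?Pc ?andbF.
rewrite natr_sum mulr_suml -sumrB mulr_sumr; apply: le_trans (ler_norm_sum _ _ _) _.
exact: ler_sum.
Qed.

(** The surplus [v - a] and the shift [wc * r] of the expected count both lie between 0 and [r], so
    their difference costs [r] only once. *)
Lemma ratio_dev {a v r m : nat} {wc : R} :
  (a <= v <= a + r)%N -> m = (n + r)%N -> (0 < m)%N -> 0 <= wc <= 1 ->
  `|a%:R - wc * n%:R| <= t * wc -> `|v%:R / m%:R - wc| <= (t * wc + r%:R) / m%:R.
Proof.
move=> /andP[av var] mE m0 /andP[wc0 wc1] dev.
have mR : 0 < m%:R :> R by rewrite ltr0n.
rewrite (_ : v%:R / m%:R - wc = (v%:R - wc * m%:R) / m%:R); last by field; rewrite gt_eqF.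
rewrite normrM normfV normr_nat ler_pM2r ?invr_gt0 //.
have avR : a%:R <= v%:R :> R by rewrite ler_nat.
have varR : v%:R <= a%:R + r%:R :> R by rewrite -natrD ler_nat.
have := mulr_ge0 wc0 (ler0n R r); have : wc * r%:R <= r%:R by rewrite ler_piMl.
move: dev; rewrite mE natrD mulrDr !ler_norml => /andP[? ?] ? ?.
by apply/andP; split; lra.
Qed.

(** The errors [t * w c] sum to [t] because [w] has mass 1; only the [r] added items are paid for
    once per type. *)
Lemma sum_ratio_dev {f g : T -> nat} (r : nat) {m : nat} :
  (forall c, 0 <= w c) -> \sum_c w c = 1 -> m = (n + r)%N -> (0 < m)%N ->
  (forall c, (f c <= g c <= f c + r)%N) ->
  (forall c, `|(f c)%:R - w c * n%:R| <= t * w c) ->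
  \sum_c `|(g c)%:R / m%:R - w c| <= (t + #|T|%:R * r%:R) / m%:R.
Proof.
move=> w0 w1 mE m0 fg dev.
have wle1 c : 0 <= w c <= 1.
  by rewrite w0 -w1 (bigD1 c) //= lerDl sumr_ge0.
apply: (le_trans (ler_sum _ (fun c _ => ratio_dev (fg c) mE m0 (wle1 c) (dev c)))).
by rewrite -mulr_suml big_split /= -mulr_sumr w1 mulr1 sumr_const mulr_natl.
Qed.

End Deviation.

(** * Counting over ordinals and sequences *)

Lemma card_ord_prefix (P : pred nat) (n r : nat) :
  (#|[set v : 'I_n | P v]| <= #|[set v : 'I_(n + r) | P v]| <= #|[set v : 'I_n | P v]| + r)%N.
Proof.
have cE m : #|[set v : 'I_m | P v]| = (\sum_(0 <= v < m) P v)%N.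
  by rewrite -sum1_card big_mkord big_mkcond; apply: eq_bigr => v _; rewrite inE; case: (P v).
rewrite !cE (@big_cat_nat _ _ _ n 0 (n + r)) ?leq_addr //= leq_add2l.
rewrite -[leqRHS](addKn n) -[leqRHS]muln1 -sum_nat_const_nat leq_sum // => v _.
exact: leq_b1.
Qed.

Lemma card_nth_count (T : eqType) (x0 : T) (l : seq T) (P : pred T) :
  #|[set e : 'I_(size l) | P (nth x0 l e)]| = count P l.
Proof.
rewrite -sum1_card -sum1_count (big_nth x0) big_mkord.
by apply: eq_bigl => e; rewrite inE.
Qed.

Lemma size_flatten_nseq (T : Type) (f : nat -> nat) (g : nat -> T) (m : nat) :
  (forall k, (0 < k <= m)%N -> (f k <= k)%N) ->
  (size (flatten [seq nseq (f k) (g k) | k <- iota 1 m]) <= m ^ 2)%N.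
Proof.
move=> fk; rewrite size_flatten /shape -map_comp sumnE big_map.
apply: (@leq_trans (\sum_(k <- iota 1 m) m)%N).
  rewrite !big_seq; apply: leq_sum => k; rewrite mem_iota add1n ltnS => km.
  by rewrite /= size_nseq (leq_trans (fk _ km)) //; case/andP: km.
by rewrite big_const_seq count_predT size_iota iter_addn_0 expnS expn1.
Qed.

(** * The laws of a single node and a single edge, and their marginals *)

Definition node_law {R : realType} (J K : nat) (p : nat -> nat -> R)
  (c : 'I_J.+1 * 'I_K.+1) : R := p c.1 c.2.
(** With these uncurried laws, [node_weight] and [edge_weight] are convertible to instances of
    [sample_weight]. *)
Definition edge_law {R : realType} (J K : nat) (q : nat -> nat -> R)
  (c : 'I_K * 'I_J) : R := q c.1.+1 c.2.+1.

Section Model.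
Context {R : realType} {J K : nat} {p q : nat -> nat -> R} {delta : R} {N : nat}.

Lemma p_out_law k : (k <= K)%N ->
  p_out J p k = \sum_(c : 'I_J.+1 * 'I_K.+1 | c.2 == k :> nat) node_law J K p c.
Proof.
move=> kK; rewrite /p_out big_mkord.
rewrite -(pair_big_dep xpredT (fun _ (i : 'I_K.+1) => i == k :> nat)
  (fun i j => node_law J K p (i, j))).
by apply: eq_bigr => i _; rewrite -[k]/(val (Ordinal (kK : k < K.+1)%N)) big_pred1_eq.
Qed.

Lemma p_in_law j : (j <= J)%N ->
  p_in K p j = \sum_(c : 'I_J.+1 * 'I_K.+1 | c.1 == j :> nat) node_law J K p c.
Proof.
move=> jJ; rewrite /p_in big_mkord.
transitivity (\sum_(i < J.+1 | i == j :> nat) \sum_k node_law J K p (i, k)).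
  by rewrite -[j]/(val (Ordinal (jJ : j < J.+1)%N)) big_pred1_eq.
by rewrite pair_big_dep; apply: eq_big => [[i k]|[i k] _] //=; rewrite andbT.
Qed.

Lemma q_out_law k : (0 < k <= K)%N ->
  q_out J q k = \sum_(c : 'I_K * 'I_J | c.1.+1 == k) edge_law J K q c.
Proof.
case: k => // k kK; rewrite /q_out big_add1 big_mkord.
transitivity (\sum_(i < K | i.+1 == k.+1) \sum_j edge_law J K q (i, j)).
  by rewrite (big_pred1 (Ordinal kK)).
by rewrite pair_big_dep; apply: eq_big => [[i j]|[i j] _] //=; rewrite andbT.
Qed.

Lemma q_in_law j : (0 < j <= J)%N ->
  q_in K q j = \sum_(c : 'I_K * 'I_J | c.2.+1 == j) edge_law J K q c.
Proof.
case: j => // j jJ; rewrite /q_in big_add1 big_mkord.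
rewrite -(pair_big_dep xpredT (fun _ (i : 'I_J) => i.+1 == j.+1)
  (fun i j => edge_law J K q (i, j))).
by apply: eq_bigr => i _; rewrite (big_pred1 (Ordinal jJ)).
Qed.

Lemma node_law_ge0 : prob_P J K p -> forall c, 0 <= node_law J K p c.
Proof. by case=> p0 _ [j k]; apply: p0; rewrite -ltnS. Qed.

Lemma edge_law_ge0 : prob_Q J K q -> forall c, 0 <= edge_law J K q c.
Proof. by case=> q0 _ [k j]; apply: q0; rewrite /= ltn_ord. Qed.

Lemma sum_node_law : prob_P J K p -> \sum_c node_law J K p c = 1.
Proof.
case=> _ <-; rewrite big_mkord -(pair_bigA _ (fun i j => node_law J K p (i, j))).
by apply: eq_bigr => i _; rewrite big_mkord.
Qed.

Lemma sum_edge_law : prob_Q J K q -> \sum_c edge_law J K q c = 1.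
Proof.
case=> _ <-; rewrite big_add1 big_mkord -(pair_bigA _ (fun i j => edge_law J K q (i, j))).
by apply: eq_bigr => i _; rewrite big_add1 big_mkord.
Qed.

Lemma type_deviationE (G : digraph N) : type_deviation J K p q G =
  \sum_(c : 'I_J.+1 * 'I_K.+1) `|(nb_nodes_of_type G c.1 c.2)%:R / N%:R - node_law J K p c| +
  \sum_(c : 'I_K * 'I_J)
    `|(nb_edges_of_type G c.1.+1 c.2.+1)%:R / (nb_edges G)%:R - edge_law J K q c|.
Proof.
congr (_ + _).
  rewrite big_mkord -[RHS](pair_bigA _ (fun (i : 'I_J.+1) (j : 'I_K.+1) =>
    `|(nb_nodes_of_type G i j)%:R / N%:R - p i j|)).
  by apply: eq_bigr => i _; rewrite big_mkord.
rewrite big_add1 big_mkord -[RHS](pair_bigA _ (fun (i : 'I_K) (j : 'I_J) =>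
    `|(nb_edges_of_type G i.+1 j.+1)%:R / (nb_edges G)%:R - q i.+1 j.+1|)).
by apply: eq_bigr => i _; rewrite big_add1 big_mkord.
Qed.

(** * The graph built from samples with small deviations *)

Context {x : node_sample J K delta N} {y : edge_sample J K p delta N}.

Let d := Ndelta delta N.
Let n := N1 J K delta N.
Let M := nb_edges1 J K p delta N.
Let z := mean_deg J K p.

(** The sampled edge types form a prefix of [edge_types]; the remaining entries can only increase a
    count, by at most their number. *)
Lemma edge_count_le (P : pred (nat * nat)) :
  (#|[set e | P ((y e).1.+1, (y e).2.+1)]| <= count P (edge_types y)
   <= #|[set e | P ((y e).1.+1, (y e).2.+1)]| + (size (edge_types y) - M))%N.
Proof.
have -> : #|[set e | P ((y e).1.+1, (y e).2.+1)]| =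
    count P [seq ((y e).1.+1, (y e).2.+1) | e <- enum 'I_M].
  rewrite count_map -sum1_card -sum1_count big_enum_cond /=.
  by apply: eq_bigl => e; rewrite !inE.
rewrite /edge_types count_cat leq_addr leq_add2l size_cat size_map size_enum_ord.
by rewrite addKn count_size.
Qed.

Lemma size_edge_types : (M <= size (edge_types y) <= M + (K ^ 2 + J ^ 2))%N.
Proof.
rewrite /edge_types size_cat size_map size_enum_ord leq_addr leq_add2l size_cat.
by rewrite leq_add // size_flatten_nseq // => k /andP[k0 _]; apply: nceil_remainder.
Qed.

Hypotheses (hP : prob_P J K p) (hQ : prob_Q J K q).
Context {t : R}.
Hypothesis node_dev : forall c,
  `|(type_count x c)%:R - node_law J K p c * n%:R| <= t * node_law J K p c.
Hypothesis edge_dev : forall c,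
  `|(type_count y c)%:R - edge_law J K q c * M%:R| <= t * edge_law J K q c.

Lemma p_out_ge0 k : (k <= K)%N -> 0 <= p_out J p k.
Proof. by move=> kK; rewrite p_out_law // sumr_ge0 // => c _; apply: node_law_ge0. Qed.

Lemma p_in_ge0 j : (j <= J)%N -> 0 <= p_in K p j.
Proof. by move=> jJ; rewrite p_in_law // sumr_ge0 // => c _; apply: node_law_ge0. Qed.

(** Node counts are handled by [event_dev] with [t <= d / 2]. For edge counts, consistency expresses
    the marginals of [q] through those of [p], which is the form [nceil_div_dev] needs, with
    [t <= z * d / 4]. *)
Lemma event_A_of_dev : consistent_out J K p q -> consistent_in J K p q -> 0 < z ->
  t <= d / 2 -> t <= z * d / 4 ->
  (forall k, (0 < k <= K)%N -> 0 < p_out J p k ->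
     1 + p_out J p k / z <= p_out J p k * d / 4) ->
  (forall j, (0 < j <= J)%N -> 0 < p_in K p j ->
     1 + p_in K p j / z <= p_in K p j * d / 4) ->
  event_A x y.
Proof.
move=> hC1 hC2 z0 td tzd large_out large_in.
apply/andP; split; apply/allP => k; rewrite mem_iota add1n ltnS => kK;
  have /andP[k0 kle] := kK; apply/andP; split.
- rewrite p_out_law //.
  apply: le_trans (event_dev x (fun c => c.2 == k :> nat) node_dev) _.
  by rewrite mulrC -mulrA ler_wpM2l // -p_out_law // p_out_ge0.
- apply: (nceil_div_dev k0 z0 (p_out_ge0 _ kle) (hC1 k kK) tzd (large_out k kK)).
  rewrite q_out_law //.
  exact: (event_dev y (fun c => c.1.+1 == k) edge_dev).
- rewrite p_in_law //.
  apply: le_trans (event_dev x (fun c => c.1 == k :> nat) node_dev) _.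
  by rewrite mulrC -mulrA ler_wpM2l // -p_in_law // p_in_ge0.
- apply: (nceil_div_dev k0 z0 (p_in_ge0 _ kle) (hC2 k kK) tzd (large_in k kK)).
  rewrite q_in_law //.
  exact: (event_dev y (fun c => c.2.+1 == k) edge_dev).
Qed.

(** Membership in the allocation sets forces every node to have its prescribed degrees. These are
    the sampled ones on the first [n] nodes, and the [N - n] reserve nodes are counted crudely. *)
Lemma nb_nodes_allocated {s s' : allocation y} (c : 'I_J.+1 * 'I_K.+1) :
  s \in source_allocations x y -> s' \in target_allocations x y ->
  (type_count x c <= nb_nodes_of_type (allocated_graph s s') c.1 c.2
    <= type_count x c + (N - n))%N.
Proof.
rewrite !inE => /andP[_ /forallP sE] /andP[_ /forallP tE].
pose P v := (nth 0%N (in_degrees x y) v == c.1) && (nth 0%N (out_degrees x y) v == c.2).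
have -> : nb_nodes_of_type (allocated_graph s s') c.1 c.2 = #|[set v : 'I_N | P v]|.
  apply: eq_card => v; rewrite !inE /P.
  by rewrite -(eqP (sE v)) -(eqP (tE v)).
have -> : type_count x c = #|[set v : 'I_n | P v]|.
  apply: eq_card => v; rewrite !inE /P /in_degrees /out_degrees !nth_cat.
  rewrite !(size_map _ (enum 'I_n)) !size_enum_ord ltn_ord.
  have nthE (f : 'I_n -> nat) : nth 0%N [seq f u | u <- enum 'I_n] v = f v.
    by rewrite (nth_map v) ?size_enum_ord // nth_ord_enum.
  by rewrite !nthE.
have := card_ord_prefix P n (N - n).
by rewrite subnKC // leq_subr.
Qed.

(** An edge leaves a node whose prescribed out-degree is the one the edge asks for, and that node
    attains it; likewise at its target. So each edge has its prescribed type in the graph. *)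
Lemma nb_edges_allocated {s s' : allocation y} (c : 'I_K * 'I_J) :
  s \in source_allocations x y -> s' \in target_allocations x y ->
  (type_count y c <= nb_edges_of_type (allocated_graph s s') c.1.+1 c.2.+1
    <= type_count y c + (size (edge_types y) - M))%N.
Proof.
rewrite !inE => /andP[/forallP sT /forallP sE] /andP[/forallP tT /forallP tE].
have -> : nb_edges_of_type (allocated_graph s s') c.1.+1 c.2.+1 =
    count (pred1 (c.1.+1, c.2.+1)) (edge_types y).
  rewrite -(card_nth_count _ (0, 0)%N); apply: eq_card => e; rewrite !inE.
  have -> : outdeg (allocated_graph s s') (s e) = (nth (0, 0)%N (edge_types y) e).1.
    by rewrite -(eqP (sT e)) -(eqP (sE (s e))).
  have -> : indeg (allocated_graph s s') (s' e) = (nth (0, 0)%N (edge_types y) e).2.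
    by rewrite -(eqP (tT e)) -(eqP (tE (s' e))).
  by case: nth.
have -> : type_count y c =
    #|[set e | pred1 (c.1.+1, c.2.+1) ((y e).1.+1, (y e).2.+1)]|.
  by apply: eq_card => e; rewrite !inE; case: (y e) c => [a b] [a' b'].
exact: edge_count_le.
Qed.

Lemma type_deviation_allocated {s s' : allocation y} :
  s \in source_allocations x y -> s' \in target_allocations x y ->
  (0 < N)%N -> (0 < M)%N -> 0 <= t ->
  type_deviation J K p q (allocated_graph s s') <=
    (t + (J.+1 * K.+1 * (N - n))%:R) / N%:R +
    (t + (K * J * (K ^ 2 + J ^ 2))%:R) / M%:R.
Proof.
move=> sS s'T N0 M0 t0; rewrite type_deviationE; apply: lerD.
  apply: le_trans (sum_ratio_dev (N - n) (node_law_ge0 hP) (sum_node_law hP)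
    _ N0 (fun c => nb_nodes_allocated c sS s'T) node_dev) _.
    by rewrite subnKC // leq_subr.
  by rewrite card_prod !card_ord -natrM.
have /andP[M_le size_le] := size_edge_types.
have E0 := leq_trans M0 M_le.
apply: le_trans (sum_ratio_dev (size (edge_types y) - M)
  (edge_law_ge0 hQ) (sum_edge_law hQ) _ E0
  (fun c => nb_edges_allocated c sS s'T) edge_dev) _.
  by rewrite subnKC.
(* The number of added edges depends on the sample: bound it by [K ^ 2 + J ^ 2] in the numerator and
   by 0 in the denominator. *)
rewrite card_prod !card_ord -natrM ler_pM ?invr_ge0 ?addr_ge0 //.
  by rewrite lerD2l ler_nat leq_mul2l leq_subLR size_le orbT.
by rewrite lef_pV2 ?posrE ?ltr0n // ler_nat.
Qed.

End Model.

(** * Averaging over allocations and samples *)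

Lemma cond_prob_graph_le1 {R : realType} {J K : nat} {p : nat -> nat -> R} {delta : R} {N : nat}
    (x : node_sample J K delta N) (y : edge_sample J K p delta N) (B : pred (digraph N)) :
  0 <= cond_prob_graph x y B <= 1.
Proof.
rewrite /cond_prob_graph; case: ifP => _; last by rewrite ler0n lern1 leq_b1.
apply/andP; split.
  by apply: sumr_ge0 => s _; apply: sumr_ge0 => s' _; rewrite divr_ge0.
set S := source_allocations x y; set T := target_allocations x y.
apply: (@le_trans _ _ (\sum_(s in S) \sum_(s' in T) (#|S| * #|T|)%:R^-1)).
  apply: ler_sum => s _; apply: ler_sum => s' _.
  by rewrite ler_piMl ?invr_ge0 // lern1 leq_b1.
rewrite !sumr_const -mulrnA (mulnC #|T|) -[leLHS]mulr_natl.
(* The equal terms sum to 1, or to 0 when an allocation set is empty. *)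
by have [->|ST] := eqVneq (#|S| * #|T|)%N 0%N; rewrite ?mul0r // mulfV // pnatr_eq0.
Qed.

Section UnionBound.
Context {R : realType} {J K : nat} {p q : nat -> nat -> R} {delta : R} {N : nat}.
Hypotheses (hP : prob_P J K p) (hQ : prob_Q J K q).

Let n := N1 J K delta N.
Let M := nb_edges1 J K p delta N.

(** The conditional probability is at most the number of types with a large deviation: it vanishes
    if there is none and never exceeds 1. Chebyshev's inequality bounds the expectation of this
    number type by type. *)
Lemma prob_graph_union_bound (B : pred (digraph N)) (t : R) : 0 < t ->
  (forall (x : node_sample J K delta N) (y : edge_sample J K p delta N),
     (forall c, `|(type_count x c)%:R - node_law J K p c * n%:R| <= t * node_law J K p c) ->
     (forall c, `|(type_count y c)%:R - edge_law J K q c * M%:R| <= t * edge_law J K q c) ->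
     cond_prob_graph x y B = 0) ->
  prob_graph J K p q delta B <=
    \sum_c n%:R / (t ^+ 2 * node_law J K p c) + \sum_c M%:R / (t ^+ 2 * edge_law J K q c).
Proof.
move=> t0 good0.
pose wP := node_law J K p; pose wQ := edge_law J K q.
pose bad_x (x : node_sample J K delta N) c := t * wP c < `|(type_count x c)%:R - wP c * n%:R|.
pose bad_y (y : edge_sample J K p delta N) c := t * wQ c < `|(type_count y c)%:R - wQ c * M%:R|.
have P0 := node_law_ge0 hP; have Q0 := edge_law_ge0 hQ.
have P1 := sum_node_law hP; have Q1 := sum_edge_law hQ.
pose F x : R := \sum_c (bad_x x c)%:R; pose G y : R := \sum_c (bad_y y c)%:R.
have F0 x : 0 <= F x by exact: sumr_ge0.
have G0 y : 0 <= G y by exact: sumr_ge0.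
have condFG x y : cond_prob_graph x y B <= F x + G y.
  have /andP[_ cond1] := cond_prob_graph_le1 x y B.
  have [/existsP[c bc]|/existsPn goodx] := boolP [exists c, bad_x x c].
    rewrite (le_trans cond1) // /F (bigD1 c) //= bc -!addrA lerDl addr_ge0 //.
    exact: sumr_ge0.
  have [/existsP[c bc]|/existsPn goody] := boolP [exists c, bad_y y c].
    rewrite (le_trans cond1) // addrC /G (bigD1 c) //= bc -!addrA lerDl addr_ge0 //.
    exact: sumr_ge0.
  rewrite good0 ?addr_ge0 // => c; rewrite leNgt; [exact: goodx|exact: goody].
apply: (@le_trans _ _ (\sum_x sample_weight wP x * F x + \sum_y sample_weight wQ y * G y)).
  apply: (@le_trans _ _ (\sum_x \sum_y (sample_weight wP x * sample_weight wQ y) * (F x + G y))).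
    apply: ler_sum => x _; apply: ler_sum => y _; apply: ler_wpM2l => //.
    exact: mulr_ge0 (sample_weight_ge0 _ P0 x) (sample_weight_ge0 _ Q0 y).
  (* [F] depends on [x] alone and [G] on [y] alone, so the weight of the other sample sums to 1. *)
  rewrite le_eqVlt; apply/orP; left; apply/eqP.
  transitivity (\sum_x (sample_weight wP x * F x +
      sample_weight wP x * \sum_y sample_weight wQ y * G y)).
    apply: eq_bigr => x _.
    under eq_bigr => y _ do rewrite mulrDr mulrAC -[X in _ + X]mulrA.
    by rewrite big_split /= -!mulr_sumr sum_sample_weight // mulr1.
  by rewrite big_split /= -mulr_suml sum_sample_weight // mul1r.
apply: lerD.
  under eq_bigr do rewrite mulr_sumr.
  by rewrite exchange_big /=; apply: ler_sum => c _; apply: type_count_chebyshev.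
under eq_bigr do rewrite mulr_sumr.
by rewrite exchange_big /=; apply: ler_sum => c _; apply: type_count_chebyshev.
Qed.

End UnionBound.

Lemma prob_graph_ge0 {R : realType} {J K : nat} {p q : nat -> nat -> R} {delta : R} {N : nat}
    (B : pred (digraph N)) :
  prob_P J K p -> prob_Q J K q -> 0 <= prob_graph J K p q delta B.
Proof.
move=> hP hQ; apply: sumr_ge0 => x _; apply: sumr_ge0 => y _.
have /andP[cond0 _] := cond_prob_graph_le1 x y B.
rewrite !mulr_ge0 //; first exact: sample_weight_ge0 _ (node_law_ge0 hP) x.
exact: sample_weight_ge0 _ (edge_law_ge0 hQ) y.
Qed.

(** Dividing by [f k], the claim becomes [(f k)^-1 + z^-1 <= d / 4]. The sum of all inverses gives a
    threshold uniform in [k]; vanishing [f k] contribute 0 to it. *)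
Lemma ge_sum_inv {R : realType} {m : nat} {f : nat -> R} {z d : R} :
  (forall k, (k <= m)%N -> 0 <= f k) ->
  4 * (\sum_(k < m.+1) (f k)^-1 + z^-1) <= d ->
  forall k, (0 < k <= m)%N -> 0 < f k -> 1 + f k / z <= f k * d / 4.
Proof.
move=> f0 ged k /andP[_ km] fk.
have : (f k)^-1 + z^-1 <= d / 4.
  rewrite ler_pdivlMr ?ltr0n // mulrC (le_trans _ ged) // ler_pM2l ?ltr0n // lerD2r.
  rewrite (bigD1 (Ordinal (km : k < m.+1)%N)) //= lerDl sumr_ge0 // => i _.
  by rewrite invr_ge0 f0 // -ltnS.
by rewrite -(ler_pM2l fk) mulrDr mulfV ?gt_eqF // mulrA.
Qed.

(* The allocation sets are not required to be nonempty: over an empty set,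
   [cond_prob_graph] sums to [0]. *)
Lemma cond_prob_graph_eq0 {R : realType} {J K : nat} {p : nat -> nat -> R} {delta : R} {N : nat}
    (x : node_sample J K delta N) (y : edge_sample J K p delta N) (B : pred (digraph N)) :
  event_A x y ->
  (forall s s', s \in source_allocations x y -> s' \in target_allocations x y ->
     ~~ B (allocated_graph s s')) ->
  cond_prob_graph x y B = 0.
Proof.
move=> Axy notB; rewrite /cond_prob_graph Axy big1 // => s sS; rewrite big1 // => s' sT.
by rewrite (negbTE (notB _ _ sS sT)) mul0r.
Qed.

(** * Choice of constants and passage to the limit *)

Local Open Scope classical_set_scope.
Local Open Scope ring_scope.

Theorem theorem2p4 (R : realType) (J K : nat) (hJ : (1 <= J)%N) (hK : (1 <= K)%N)
    (p q : nat -> nat -> R)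
    (hP : prob_P J K p) (hQ : prob_Q J K q)
    (hz : 0 < mean_deg J K p)
    (hC1 : consistent_out J K p q) (hC2 : consistent_in J K p q)
    (delta : R) (hdelta : 1 / 2 < delta < 1)
    (eps : R) (heps : 0 < eps) :
  prob_graph J K p q delta
      (fun G : digraph N => eps < type_deviation J K p q G)
    @[N --> within [set N : nat | admissible J K delta N] \oo] --> (0 : R).
Proof.
have /andP[d12 d1] := hdelta.
set z := mean_deg J K p in hz.
(* The tolerance will be [tau * d] with [d] equal to [Ndelta]: the bound 1/2 serves the node counts
   in [event_A], and [z / 4] the edge counts. *)
pose tau : R := Num.min (1 / 2) (z / 4).
have tau0 : 0 < tau by rewrite lt_min !divr_gt0.
pose wP := node_law J K p; pose wQ := edge_law J K q.
(* With tolerance [tau * d] the union bound is at most [D * N / d ^+ 2]; the factor [z + 1] comes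
   from [M <= (z + 1) * N]. *)
pose D := \sum_c (tau ^+ 2 * wP c)^-1 + (z + 1) * \sum_c (tau ^+ 2 * wQ c)^-1.
pose Dout : R := 4 * (\sum_(k < K.+1) (p_out J p k)^-1 + z^-1).
pose Din : R := 4 * (\sum_(j < J.+1) (p_in K p j)^-1 + z^-1).
pose C : R := (maxn (J ^ 2) (K ^ 2))%:R.
pose AV : R := (J.+1 * K.+1)%:R.
pose AE : R := (K * J * (K ^ 2 + J ^ 2))%:R.
(* [L * eps] is the coefficient of [d / N] in the bound on the type deviation; [4 + C] comes from
   the reserve and [2 / z] from [M >= z * N / 2]. *)
pose L := (1 + AV * (4 + C) + 2 * (1 + AE) / z) / eps.
have C0 : 0 <= C by exact: ler0n.
have delta_gt0 : 0 < delta by apply: lt_trans d12; rewrite divr_gt0.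
have delta2_gt1 : 1 < delta + delta by lra.
(* Constants are negligible against [N ^ delta], which is negligible against [N], which in turn is
   negligible against [N ^ (2 delta)] because [delta > 1/2]. *)
have large_d c := powR_dominates c (lexx _) delta_gt0.
have small_d c := powR_dominates c (ltW delta_gt0) d1.
have large_d2 c := powR_dominates c ler01 delta2_gt1.
apply/cvgrPdist_le => e e0; rewrite near_withinE.
near=> N => admN.
have N0 : 0 < N%:R :> R by rewrite ltr0n; near: N; exact: nbhs_infty_gt.
have d_ge1 : 1 * N%:R `^ 0 <= N%:R `^ delta by near: N; exact: large_d.
have d_geout : Dout * N%:R `^ 0 <= N%:R `^ delta by near: N; exact: large_d.
have d_gein : Din * N%:R `^ 0 <= N%:R `^ delta by near: N; exact: large_d.
have LdN : L * N%:R `^ delta <= N%:R `^ 1 by near: N; exact: small_d.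
(* This keeps the reserve below half of the nodes. *)
have CdN : 2 * (4 + C) * N%:R `^ delta <= N%:R `^ 1 by near: N; exact: small_d.
have DNd : D / e * N%:R `^ 1 <= N%:R `^ (delta + delta) by near: N; exact: large_d2.
pose d : R := Ndelta delta N; pose n := N1 J K delta N; pose M := nb_edges1 J K p delta N.
have dge c : c * N%:R `^ 0 <= d -> c <= d by rewrite powRr0 mulr1.
have dN c : c * d <= N%:R `^ 1 -> c * d <= N%:R by rewrite powRr1 // (ltW N0).
have {}d_ge1 := dge _ d_ge1; have {}d_geout := dge _ d_geout; have {}d_gein := dge _ d_gein.
have {}LdN := dN _ LdN; have {}CdN := dN _ CdN.
have {}DNd : D / e * N%:R <= d ^+ 2.
  move: DNd; rewrite powRr1 ?(ltW N0) // expr2 powRD //.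
  by rewrite (gt_eqF N0) !implybT.
have d0 : 0 < d by exact: lt_le_trans d_ge1.
have [N' N'0 NE] := admN.
have RN : (nb_reserve J K delta N <= N)%N by rewrite {2}NE leq_addl.
have reserveE : (N - n)%N = nb_reserve J K delta N by rewrite /n /N1 subKn.
(* As [1 <= d], the reserve is at most [2 * (d + 1) + C <= (4 + C) * d]. *)
have reserve_le : (nb_reserve J K delta N)%:R <= (4 + C) * d.
  have ceild := nceil_lt d (ltW d0); rewrite natrD natrM -/d -/C.
  have := ler_wpM2l C0 d_ge1; lra.
have nR : n%:R = N%:R - (nb_reserve J K delta N)%:R :> R by rewrite -natrB.
have N2N : (N2 J K delta N <= N)%N.
  rewrite /N2 /N1 -[leqRHS](subnK RN) leq_add2l /nb_reserve mul2n -addnn -addnA.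
  exact: leq_addr.
have n_half : N%:R / 2 <= n%:R :> R by rewrite nR; lra.
have M_ge : z * N%:R / 2 <= M%:R.
  apply: le_trans (nceil_ge _); rewrite -/z -mulrA ler_pM2l //.
  by rewrite (le_trans n_half) // ler_nat leq_addr.
have M0 : 0 < M%:R :> R by apply: lt_le_trans M_ge; rewrite divr_gt0 ?mulr_gt0.
have M_le : M%:R <= (z + 1) * N%:R.
  apply: le_trans (ltW (nceil_lt _ _)) _; first by rewrite mulr_ge0 // ltW.
  rewrite mulrDl mul1r lerD //; first by rewrite ler_pM2l // ler_nat.
  by rewrite ler1n -(ltr0n R).
have taud : tau * d <= d / 2.
  by rewrite mulrC ler_pM2l // ge_min mul1r lexx.
have tauzd : tau * d <= z * d / 4.
  by rewrite mulrAC ler_pM2r // ge_min lexx orbT.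
have dev_small : (tau * d + (J.+1 * K.+1 * (N - n))%:R) / N%:R +
    (tau * d + (K * J * (K ^ 2 + J ^ 2))%:R) / M%:R <= eps.
  rewrite -/AE natrM -/AV reserveE.
  have AV0 : 0 <= AV by exact: ler0n.
  have AE0 : 0 <= AE by exact: ler0n.
  (* Here [tau * d <= d], while [1 <= d] turns the constant [AE] into a multiple of [d]. *)
  apply: (@le_trans _ _ ((1 + AV * (4 + C)) * d / N%:R + (1 + AE) * d / (z * N%:R / 2))).
    apply: lerD.
      rewrite ler_pM2r ?invr_gt0 // mulrDl mul1r lerD //; first lra.
      by rewrite -mulrA ler_wpM2l.
    rewrite ler_pM ?invr_ge0 ?addr_ge0 // ?(ltW M0) //.
    - by rewrite mulr_ge0 // ltW.
    - by have := ler_wpM2l AE0 d_ge1; lra.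
    - by rewrite lef_pV2 ?posrE // divr_gt0 ?mulr_gt0.
  rewrite [leLHS](_ : _ = eps * (L * d / N%:R)); last by rewrite /L; field; rewrite !gt_eqF.
  by rewrite ger_pMr // ler_pdivrMr // mul1r.
rewrite sub0r normrN ger0_norm; last exact: prob_graph_ge0.
apply: (@le_trans _ _ (N%:R / d ^+ 2 * D)); last first.
  rewrite mulrC mulrA ler_pdivrMr ?exprn_gt0 //.
  by move: DNd; rewrite mulrAC ler_pdivrMr // [leRHS]mulrC.
apply: le_trans (prob_graph_union_bound hP hQ _ (tau * d) _ _) _.
- exact: mulr_gt0.
- move=> x y devx devy; apply: cond_prob_graph_eq0.
    apply: (event_A_of_dev hP devx devy) => //.
      by apply: ge_sum_inv d_geout => k; apply: p_out_ge0.
    by apply: ge_sum_inv d_gein => j; apply: p_in_ge0.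
  move=> s s' sS s'T; rewrite -leNgt (le_trans _ dev_small) //.
  apply: (type_deviation_allocated hP hQ devx devy) => //.
  + by rewrite -(ltr0n R).
  + by rewrite -(ltr0n R).
  + by rewrite mulr_ge0 // ltW.
(* Pulling the powers of [d] out of the inverses is also valid at types of weight 0, where both
   sides are 0. *)
have rescale (T : finType) (w : T -> R) (m : R) :
    \sum_c m / ((tau * d) ^+ 2 * w c) = m / d ^+ 2 * \sum_c (tau ^+ 2 * w c)^-1.
  rewrite mulr_sumr; apply: eq_bigr => c _.
  by rewrite exprMn mulrAC invfM mulrCA mulrC.
have wP0 : 0 <= \sum_c (tau ^+ 2 * wP c)^-1.
  by apply: sumr_ge0 => c _; rewrite invr_ge0 mulr_ge0 ?sqr_ge0 //; apply: node_law_ge0.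
have wQ0 : 0 <= \sum_c (tau ^+ 2 * wQ c)^-1.
  by apply: sumr_ge0 => c _; rewrite invr_ge0 mulr_ge0 ?sqr_ge0 //; apply: edge_law_ge0.
rewrite !rescale /D mulrDr mulrA; apply: lerD; apply: ler_wpM2r => //.
  by rewrite ler_pM2r ?invr_gt0 ?exprn_gt0 // ler_nat leq_subr.
by rewrite mulrAC ler_pM2r ?invr_gt0 ?exprn_gt0 // mulrC.
Unshelve. all: by end_near.
Qed.
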